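(* Let $\mathcal{M}=\{M^x:x\in\Lambda\}$ be a weight matrix. (i) $\mathcal{E}_{\{\mathcal{M}\}}$ is non-quasianalytic if and only if there exists $x_0\in\Lambda$ such that $\mathcal{E}_{[M^{x_0}]}$ is non-quasianalytic. (ii) Provided $\Lambda=\mathbb{R}_{>0}$ (with its natural order): $\mathcal{E}_{(\mathcal{M})}$ is non-quasianalytic if and only if $\mathcal{E}_{[M^x]}$ is non-quasianalytic for each $x\in\Lambda$. Here $\mathcal{E}_{[M^x]}$ may be read as either of $\mathcal{E}_{\{M^x\}}$ and $\mathcal{E}_{(M^x)}$; the assertions hold with either reading.
   Context: $\mathbb{N}=\{0,1,2,\dots\}$. $(\Lambda,\le)$ is a partially ordered set which is both upward and downward directed. A weight matrix is a family $\mathcal{M}=\{M^x:x\in\Lambda\}$ of sequences $M^x=(M^x_k)_{k\in\mathbb{N}}$ of positive reals which are normalized ($1=M^x_0\le M^x_1$) and increasing, with $M^x\le M^y$ (termwise) for $x\le y$. For a positive sequence $M$, a compact set $K\subset\mathbb{R}^r$ and $h>0$, put $\|f\|_{M,K,h}:=\sup_{k\in\mathbb{N},x\in K}\frac{\|f^{(k)}(x)\|}{h^kM_k}$, where $f^{(k)}$ is the $k$-th Fréchet derivative with the operator norm on $k$-linear maps. For $U\subseteq\mathbb{R}^r$ non-empty open, $\mathcal{E}_{\{M\}}(U)$ (resp. $\mathcal{E}_{(M)}(U)$) is the set of smooth $f$ on $U$ such that for every compact $K\subset U$, $\|f\|_{M,K,h}<\infty$ for some (resp. all) $h>0$. $\mathcal{E}_{\{\mathcal{M}\}}(U)$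 (resp. $\mathcal{E}_{(\mathcal{M})}(U)$) is the set of smooth $f$ on $U$ such that for every compact $K\subset U$, $\|f\|_{M^x,K,h}<\infty$ for some $x\in\Lambda$ and some $h>0$ (resp. for all $x\in\Lambda$ and all $h>0$). A class $\mathcal{E}_\star$ of this kind is called non-quasianalytic if it contains non-trivial functions with compact support (i.e. $\mathcal{E}_\star(\mathbb{R}^r)$ contains a function with compact support that is not identically zero). *)

(* Defs.v *)
From HB Require Import structures.
From mathcomp Require Import all_boot all_order all_algebra.
From mathcomp Require Import all_classical all_reals all_analysis.

Set Implicit Arguments.
Unset Strict Implicit.
Unset Printing Implicit Defensive.

Import Order.TTheory GRing.Theory Num.Theory.
Import numFieldNormedType.Exports.

Local Open Scope classical_set_scope.
Local Open Scope ring_scope.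

Definition upward_directed d (L : porderType d) : Prop :=
  forall x y : L, exists z : L, (x <= z)%O /\ (y <= z)%O.

Definition downward_directed d (L : porderType d) : Prop :=
  forall x y : L, exists z : L, (z <= x)%O /\ (z <= y)%O.

Record weight_matrix (R : realType) d (L : porderType d) (M : L -> nat -> R) :
    Prop := WeightMatrix {
  wm_up : upward_directed L;
  wm_down : downward_directed L;
  wm_pos : forall x k, 0 < M x k;
  wm_norm0 : forall x, M x 0%N = 1;
  wm_norm1 : forall x, 1 <= M x 1%N;
  wm_incr : forall x k, M x k <= M x k.+1;
  wm_mono : forall x y : L, (x <= y)%O -> forall k, M x k <= M y k }.

Section Ultradifferentiable.
Variables (R : realType) (r : nat).
Implicit Types (f : 'rV[R]_r -> R) (U K : set 'rV[R]_r) (M : nat -> R).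

(* The library's norm on 'rV[R]_r is the maximum norm. *)
Definition euclidean_norm (v : 'rV[R]_r) : R :=
  Num.sqrt (\sum_(i < r) v 0 i ^+ 2).

(* The k-th Frechet derivative is used in evaluated form: for vs of length k,
   frechet f vs x is f^(k)(x)(vs), and
   f^(k+1)(x)(v, v_1, .., v_k) = (D f^(k))(x)(v) evaluated at (v_1, .., v_k). *)
Fixpoint frechet f (vs : seq 'rV[R]_r) : 'rV[R]_r -> R :=
  if vs is v :: ws then fun x => 'd (frechet f ws) x v else f.

(* As k-linear maps on R^r form a finite-dimensional space, differentiability
   of f^(k) in operator norm is differentiability of all its evaluations.
   For open U only the values of f on U matter. *)
Definition smooth_on U f : Prop :=
  forall (vs : seq 'rV[R]_r) x, U x -> differentiable (frechet f vs) x.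

Definition operator_norm k (T : k.-tuple 'rV[R]_r -> R) : \bar R :=
  ereal_sup [set `|T v|%:E | v in
    [set v : k.-tuple 'rV[R]_r | forall i, euclidean_norm (tnth v i) <= 1]].

(* Equal to -oo when K is empty. *)
Definition ultra_norm M K (h : R) f : \bar R :=
  ereal_sup [set (operator_norm (fun v : k.-tuple _ => frechet f v x)
                  * ((h ^+ k * M k)^-1)%:E)%E | k in [set: nat] & x in K].

Definition roumieu M U : set ('rV[R]_r -> R) :=
  [set f | smooth_on U f /\ forall K, compact K -> K `<=` U ->
     exists2 h : R, 0 < h & (ultra_norm M K h f < +oo)%E].

Definition beurling M U : set ('rV[R]_r -> R) :=
  [set f | smooth_on U f /\ forall K, compact K -> K `<=` U ->
     forall h : R, 0 < h -> (ultra_norm M K h f < +oo)%E].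

Definition roumieu_matrix (L : Type) (MM : L -> nat -> R) U :
    set ('rV[R]_r -> R) :=
  [set f | smooth_on U f /\ forall K, compact K -> K `<=` U ->
     exists x : L, exists2 h : R, 0 < h & (ultra_norm (MM x) K h f < +oo)%E].

Definition beurling_matrix (L : Type) (MM : L -> nat -> R) U :
    set ('rV[R]_r -> R) :=
  [set f | smooth_on U f /\ forall K, compact K -> K `<=` U ->
     forall (x : L) (h : R), 0 < h -> (ultra_norm (MM x) K h f < +oo)%E].

Definition non_quasianalytic
    (E : set 'rV[R]_r -> set ('rV[R]_r -> R)) : Prop :=
  exists f, [/\ E setT f, compact (closure [set x | f x != 0])
              & exists x, f x != 0].

End Ultradifferentiable.

Variant class_type := Roumieu | Beurling.

Definition ultra_class (c : class_type) (R : realType) (r : nat)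
    (M : nat -> R) : set 'rV[R]_r -> set ('rV[R]_r -> R) :=
  match c with Roumieu => roumieu M | Beurling => beurling M end.

(* Main.v *)
(** The class of [M] is non-quasianalytic iff [sum_k 2 ^- slope k] converges, where
[2 ^+ slope k] stands for the quotient of consecutive terms of the largest
log-convex minorant of [M]. This criterion does not distinguish the Roumieu from
the Beurling class.

Necessity is Bang's argument on a line through the support. At the indices where
the minorant touches [M] the derivatives of [f] are controlled by the minorant; as
[f] vanishes to infinite order at a point [x0], the derivatives of order below such
an index [m] start from 0, and moving to the right over a distance comparable to
[2 ^- slope n] costs only a factor [e], for [n = m - 1, m - 2, ...]. If the sum
diverged, any point could be reached from [x0] with a gain [e ^- n] left, for [n]
arbitrarily large, and [f] would vanish.

For sufficiency, given countably many convergent sums, pick one summable sequence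
[a] whose terms eventually exceed [c * 2 ^- slope k] for every constant [c] and every
weight sequence, and average a tent function over intervals of lengths
[a 0, a 1, ...]. Its k-th derivative is at most [C * 2 ^+ k / (a 0 ... a (k - 1))],
so a tensor product of such functions lies in all Beurling classes at once.
A compact segment determines a single [x0] in the Roumieu matrix case, and in the
Beurling matrix case the indices [1 / n] are coinitial. *)

Require Import Defs.
From mathcomp Require Import all_boot all_order all_algebra.
From mathcomp Require Import all_classical all_reals all_analysis.
From mathcomp Require Import ring lra.

Set Implicit Arguments.
Unset Strict Implicit.
Unset Printing Implicit Defensive.

Import Order.TTheory GRing.Theory Num.Theory.
Import numFieldNormedType.Exports.

Local Open Scope classical_set_scope.
Local Open Scope ring_scope.

(** * Iterated averages and smooth functions with compact support *)

Section Averages.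
Variable R : realType.
Implicit Types (f g F G : R -> R) (a : nat -> R).

Lemma lipschitz1_continuous g : (forall x y, `|g x - g y| <= `|x - y|) ->
  continuous g.
Proof.
move=> gl x; apply/cvgrPdist_lt => e e0; near=> y.
apply: le_lt_trans (gl _ _) _; near: y.
exact: (@cvgr_dist_lt _ _ _ _ _ id x (@cvg_id _ _)).
Unshelve. all: by end_near. Qed.

Lemma is_derive_continuous F f : (forall x : R, is_derive x 1 F (f x)) ->
  continuous F.
Proof.
by move=> dF x; apply: differentiable_continuous; exact/derivable1_diffP.
Qed.

(** The mean value theorem stands in for integral estimates: an average over [[x - b, x]] is a value
    of the integrand on that interval. *)
Lemma mean_quotient F f (b x : R) : 0 < b ->
  (forall x : R, is_derive x 1 F (f x)) ->
  exists c, [/\ x - b <= c, c <= x & (F x - F (x - b)) / b = f c].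
Proof.
move=> b0 dF; have xb : x - b < x by rewrite ltrBlDr ltrDl.
have [c] := MVT xb (fun y _ => dF y)
  (continuous_subspaceT (is_derive_continuous dF)).
rewrite in_itv /= => /andP[c1 c2] ->; exists c; split; rewrite ?ltW//.
by rewrite opprB addrCA subrr addr0 mulfK// gt_eqF.
Qed.

Lemma is_derive_comp_sub F f (b x : R) : (forall x : R, is_derive x 1 F (f x)) ->
  is_derive x 1 (fun y => F (y - b)) (f (x - b)).
Proof.
move=> dF; have dx := is_derive_shift x 1 (- b).
have := @is_derive1_comp _ F (shift (- b)) x (f (x - b)) 1 (dF _) dx.
by rewrite mulr1.
Qed.

Definition primitive g (x : R) : R :=
  (\int[lebesgue_measure]_(t in `]-oo, x]) g t)%R.

Definition average (b : R) g (x : R) : R :=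
  (primitive g x - primitive g (x - b)) / b.

(** Vanishing on the left makes the integral from [-oo] finite; the Lipschitz constant 1 bounds the
    effect of an average of length [b] by [b]. Averaging preserves both properties. *)
Definition lipschitz_on_right g :=
  (forall x y, `|g x - g y| <= `|x - y|) /\ (forall x, x < 0 -> g x = 0).

Lemma is_derive_primitive g (x : R) : lipschitz_on_right g ->
  is_derive x 1 (primitive g) (g x).
Proof.
move=> [gl g0]; have gc := lipschitz1_continuous gl.
pose u := `|x| + 1.
have xu : x < u by rewrite /u (le_lt_trans (ler_norm _))// ltrDl.
have u0 : 0 <= u by rewrite /u addr_ge0.
have [||df <-] := @continuous_FTC1 R g -oo%O x u xu _ _ (gc x).
- apply/integrable_mkcond => //.
  (* As [g] vanishes on the negative half-line, integrability reduces to a compact interval. *)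
  have -> : (EFin \o g) \_ [set` Interval -oo%O (BRight u)] =
            (EFin \o g) \_ `[0, u].
    apply/funext => y; rewrite !patchE !mem_setE !in_itv /=.
    by case: (ltP y 0) => [/g0 gy|//] /=; case: ifP; rewrite // gy.
  apply: (iffLR (integrable_mkcond _ _)) => //.
  apply: continuous_compact_integrable; first exact: segment_compact.
  exact: continuous_subspaceT.
- by rewrite ltNyr.
- rewrite derive1E; exact: derivableP.
Qed.

Lemma averageE (b : R) g (x : R) : 0 < b -> lipschitz_on_right g ->
  exists c, [/\ x - b <= c, c <= x & average b g x = g c].
Proof.
by move=> b0 hg; apply: mean_quotient => // y; exact: is_derive_primitive.
Qed.

Lemma is_derive_average (b : R) g (x : R) : lipschitz_on_right g ->
  is_derive x 1 (average b g) ((g x - g (x - b)) / b).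
Proof.
move=> hg.
have d1 y := is_derive_primitive y hg.
have d2 := is_derive_comp_sub b x d1.
have := is_deriveZ b^-1 (is_deriveB (d1 x) d2).
rewrite /GRing.scale /= mulrC; apply: near_eq_is_derive.
by near=> y; rewrite /average mulrC.
Unshelve. all: by end_near. Qed.

Lemma average_contract (b : R) f g (e : R) : 0 < b ->
  lipschitz_on_right f -> lipschitz_on_right g ->
  (forall x, `|f x - g x| <= e) ->
  forall x, `|average b f x - average b g x| <= e.
Proof.
move=> b0 hf hg fg x.
have dH y := is_deriveB (is_derive_primitive y hf) (is_derive_primitive y hg).
have [c [_ _ E]] := mean_quotient x b0 dH.
have -> : average b f x - average b g x = f c - g c.
  by rewrite -E /average !fctE; field; rewrite gt_eqF.
exact: fg.
Qed.

(** The difference of the averages at [x] and [y] is a single difference quotient, that of the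
    primitive minus its translate by [x - y]. *)
Lemma average_lipschitz (b : R) g : 0 < b -> lipschitz_on_right g ->
  lipschitz_on_right (average b g).
Proof.
move=> b0 hg; split=> [x y|x x0]; last first.
  by have [c [_ cx ->]] := averageE x b0 hg; apply: hg.2; exact: le_lt_trans cx _.
have d1 z := is_derive_primitive z hg.
have dH z := is_deriveB (d1 z) (is_derive_comp_sub (x - y) z d1).
have [c [_ _ E]] := mean_quotient x b0 dH.
have -> : average b g x - average b g y = g c - g (c - (x - y)).
  rewrite -E /average !fctE.
  have -> : x - (x - y) = y by ring.
  have -> : x - b - (x - y) = y - b by ring.
  by field; rewrite gt_eqF.
apply: le_trans (hg.1 _ _) _.
by have -> : c - (c - (x - y)) = x - y by ring.
Qed.

End Averages.

(** * Limits of iterated averages *)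

Section InfiniteAverage.
Variable R : realType.
Implicit Types (f g : R -> R) (a : nat -> R).

Fixpoint iter_average g (m : nat) a : R -> R :=
  if m is m'.+1 then average (a 0%N) (iter_average g m' (fun i => a i.+1)) else g.

Definition infinite_average g a (x : R) : R :=
  limn (fun m => iter_average g m a x).

Section Iteration.
Variable g : R -> R.
Hypothesis hg : lipschitz_on_right g.

Lemma iter_average_lipschitz m a : (forall i, 0 < a i) ->
  lipschitz_on_right (iter_average g m a).
Proof.
by elim: m a => //= m IH a a0; apply: average_lipschitz => //; exact: IH.
Qed.

Lemma iter_averageE m a (x : R) : (forall i, 0 < a i) ->
  exists c, [/\ x - series a m <= c, c <= x & iter_average g m a x = g c].
Proof.
elim: m a x => [|m IH] a x a0 /=.
  by exists x; rewrite /series /= big_geq// subr0.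
have hm := iter_average_lipschitz m (fun i => a0 i.+1).
have [c [c1 c2 ->]] := averageE x (a0 0%N) hm.
have [c' [c1' c2' ->]] := IH _ c (fun i => a0 i.+1).
exists c'; split => //; last exact: le_trans c2' _.
apply: le_trans c1'; rewrite /series /= big_nat_recl//= opprD addrA lerD2r//.
Qed.

(** The additional average is the innermost one; it moves the 1-Lipschitz [g] by at most [a m], and
    the outer averages are contractions for the uniform distance. *)
Lemma iter_average_step m a (x : R) : (forall i, 0 < a i) ->
  `|iter_average g m.+1 a x - iter_average g m a x| <= a m.
Proof.
elim: m a x => [|m IH] a x a0.
  have [c [c1 c2 /= ->]] := averageE x (a0 0%N) hg.
  apply: le_trans (hg.1 _ _) _; rewrite distrC ger0_norm ?subr_ge0//.
  by rewrite lerBlDr -lerBlDl.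
exact: (average_contract (a0 0%N)
  (iter_average_lipschitz m.+1 (fun i => a0 i.+1))
  (iter_average_lipschitz m (fun i => a0 i.+1)) (fun y => IH _ y (fun i => a0 i.+1))).
Qed.

Lemma iter_average_dist a (x : R) m n : (forall i, 0 < a i) -> (m <= n)%N ->
  `|iter_average g n a x - iter_average g m a x| <= series a n - series a m.
Proof.
move=> a0; elim: n => [|n IH]; first by rewrite leqn0 => /eqP ->; rewrite !subrr normr0.
rewrite leq_eqVlt => /orP[/eqP ->|]; first by rewrite !subrr normr0.
rewrite ltnS => /IH mn.
rewrite -[X in `|X|](subrKA (iter_average g n a x)).
apply: le_trans (ler_normD _ _) _.
rewrite seriesSr addrAC addrC lerD//; exact: iter_average_step.
Qed.

Lemma iter_average_cvg a (x : R) : (forall i, 0 < a i) -> cvgn (series a) ->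
  cvgn (fun m => iter_average g m a x).
Proof.
move=> a0 ca.
have E m : iter_average g m a x =
    g x + series (fun i => iter_average g i.+1 a x - iter_average g i a x) m.
  by rewrite /series /= telescope_sumr// addrC subrK.
rewrite (_ : (fun m => _) = (fun m => g x +
    series (fun i => iter_average g i.+1 a x - iter_average g i a x) m));
  last exact/funext.
apply: is_cvgD; first exact: is_cvg_cst.
apply: normed_cvg; apply: series_le_cvg ca => n /=.
- exact: normr_ge0.
- exact: ltW.
- exact: iter_average_step.
Qed.

(** Uniformity in [x] is what allows the limit to pass through an average in
    [infinite_average_fix]. *)
Lemma infinite_average_dist a (x : R) m : (forall i, 0 < a i) ->
  cvgn (series a) ->
  `|infinite_average g a x - iter_average g m a x| <= limn (series a) - series a m.
Proof.
move=> a0 ca; have cx := iter_average_cvg (x := x) a0 ca.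
rewrite ler_norml; apply/andP; split.
  rewrite lerBrDr; apply: limr_ge => //; near=> n.
  have mn : (m <= n)%N by near: n; exists m.
  have := iter_average_dist x a0 mn; rewrite ler_norml => /andP[h _].
  have h2 : series a n <= limn (series a).
    by apply: nondecreasing_cvgn_le ca _; apply: nondecreasing_series => *; exact: ltW.
  lra.
rewrite lerBlDr; apply: limr_le => //; near=> n.
have mn : (m <= n)%N by near: n; exists m.
have := iter_average_dist x a0 mn; rewrite ler_norml => /andP[_ h].
have h2 : series a n <= limn (series a).
  by apply: nondecreasing_cvgn_le ca _; apply: nondecreasing_series => *; exact: ltW.
lra.
Unshelve. all: by end_near. Qed.

Lemma infinite_average_lipschitz a : (forall i, 0 < a i) -> cvgn (series a) ->
  lipschitz_on_right (infinite_average g a).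
Proof.
move=> a0 ca; split=> [x y|x x0].
  rewrite /infinite_average -limB; [|exact: iter_average_cvg..].
  rewrite -lim_norm; last by apply: is_cvgB; exact: iter_average_cvg.
  apply: limr_le.
    by apply: is_cvg_norm; apply: is_cvgB; exact: iter_average_cvg.
  by near=> n; exact: (iter_average_lipschitz n a0).1.
rewrite /infinite_average (_ : (fun _ => _) = cst 0) ?lim_cst//.
by apply/funext => m; exact: (iter_average_lipschitz m a0).2.
Unshelve. all: by end_near. Qed.

Lemma cvg_series_shift a : cvgn (series a) -> cvgn (series (fun i => a i.+1)).
Proof.
move=> ca; rewrite (_ : series _ = fun n => series a n.+1 - a 0%N); last first.
  by apply/funext => n; rewrite /series /= big_nat_recl// addrC addKr.
apply: is_cvgB; last exact: is_cvg_cst.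
by apply: (cvgP (limn (series a))); rewrite (cvg_shiftS (series a)).
Qed.

Lemma infinite_average_fix a (x : R) : (forall i, 0 < a i) -> cvgn (series a) ->
  infinite_average g a x = average (a 0%N) (infinite_average g (fun i => a i.+1)) x.
Proof.
move=> a0 ca; have cb := cvg_series_shift ca; set b := fun i => a i.+1 in cb *.
have b0 i : 0 < b i by exact: a0.
apply: (@cvg_unique _ _ ((fun m => iter_average g m.+1 a x) @ \oo)) => //.
  have : (fun m => iter_average g m a x) @ \oo --> infinite_average g a x.
    exact: iter_average_cvg.
  by rewrite -cvg_shiftS.
apply/cvgrPdist_le => e e0; near=> m => /=.
apply: (average_contract (a0 0%N)) => [||y].
- exact: infinite_average_lipschitz.
- exact: iter_average_lipschitz.
- apply: le_trans (infinite_average_dist _ _ _ _) _ => //.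
  apply: le_trans (ler_norm _) _; near: m.
  by move: cb => /cvgrPdist_le/(_ e e0).
Unshelve. all: by end_near. Qed.

Lemma is_derive_infinite_average a (x : R) : (forall i, 0 < a i) ->
  cvgn (series a) -> let b := fun i => a i.+1 in
  is_derive x 1 (infinite_average g a)
    ((infinite_average g b x - infinite_average g b (x - a 0%N)) / a 0%N).
Proof.
move=> a0 ca b.
rewrite (_ : infinite_average g a = average (a 0%N) (infinite_average g b)).
  apply: is_derive_average; apply: infinite_average_lipschitz => [i|]; first exact: a0.
  exact: cvg_series_shift.
by apply/funext => y; exact: infinite_average_fix.
Qed.

(** Each iterate at [x] is a value of [g] at distance at most the sum of [a] to the left of [x]. *)
Lemma infinite_average_range a (x lo hi : R) : (forall i, 0 < a i) ->
  cvgn (series a) ->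
  (forall y, x - limn (series a) <= y <= x -> lo <= g y <= hi) ->
  lo <= infinite_average g a x <= hi.
Proof.
move=> a0 ca gx.
have H m : lo <= iter_average g m a x <= hi.
  have [c [c1 c2 ->]] := iter_averageE m x a0.
  apply: gx; rewrite c2 andbT; apply: le_trans c1; rewrite lerD2l lerN2.
  by apply: nondecreasing_cvgn_le ca _; apply: nondecreasing_series => *; exact: ltW.
apply/andP; split.
  apply: limr_ge; first exact: iter_average_cvg.
  by near=> m; case/andP: (H m).
apply: limr_le; first exact: iter_average_cvg.
by near=> m; case/andP: (H m).
Unshelve. all: by end_near. Qed.

End Iteration.

Definition tent (H x : R) : R := Num.max 0 (H - `|x - H|).

Lemma tent_lipschitz (H : R) : 0 <= H -> lipschitz_on_right (tent H).
Proof.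
move=> H0; split=> [x y|x x0]; last first.
  rewrite /tent; apply/max_idPl; rewrite subr_le0 distrC ger0_norm; lra.
have : `|(x - H)| - `|y - H| <= `|x - y|.
  by apply: le_trans (lerB_dist _ _) _; rewrite opprB addrA subrK.
have : `|(y - H)| - `|x - H| <= `|x - y|.
  by rewrite (distrC x y); apply: le_trans (lerB_dist _ _) _; rewrite opprB addrA subrK.
have := normr_ge0 (x - y).
rewrite /tent; move: `|x - H| `|y - H| `|x - y| => u v w w0 h1 h2.
by rewrite /Num.max !subr_gt0 ler_norml; case: ltP => ?; case: ltP => ?;
  apply/andP; split; lra.
Qed.

(** By [infinite_average_fix] a derivative is a difference quotient of the average along the shifted
    sequence, so derivatives of all orders are iterated differences. *)
Fixpoint infinite_average_deriv g (k : nat) a : R -> R :=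
  if k is k'.+1 then fun x =>
    (infinite_average_deriv g k' (fun i => a i.+1) x
     - infinite_average_deriv g k' (fun i => a i.+1) (x - a 0%N)) / a 0%N
  else infinite_average g a.

Lemma is_derive_infinite_average_deriv g k a (x : R) : lipschitz_on_right g ->
  (forall i, 0 < a i) -> cvgn (series a) ->
  is_derive x 1 (infinite_average_deriv g k a) (infinite_average_deriv g k.+1 a x).
Proof.
move=> hg; elim: k a x => [|k IH] a x a0 ca; first exact: is_derive_infinite_average.
have d1 (y : R) := IH _ y (fun i => a0 i.+1) (cvg_series_shift ca).
have := is_deriveZ (a 0%N)^-1 (is_deriveB (d1 x) (is_derive_comp_sub (a 0%N) x d1)).
rewrite /GRing.scale /= mulrC; apply: near_eq_is_derive.
by near=> y; rewrite /= mulrC.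
Unshelve. all: by end_near. Qed.

(** Each difference quotient costs a factor [2 / a i]. The bound [H] is assumed for every sequence
    because the recursion shifts [a]. *)
Lemma infinite_average_deriv_bound g k a (x H : R) :
  (forall i, 0 < a i) ->
  (forall (b : nat -> R) (y : R), (forall i, 0 < b i) -> cvgn (series b) ->
    `|infinite_average g b y| <= H) -> cvgn (series a) ->
  `|infinite_average_deriv g k a x| <= H * 2 ^+ k / \prod_(i < k) a i.
Proof.
move=> + hH; elim: k a x => [|k IH] a x a0 ca.
  by rewrite big_ord0 expr0 mulr1 divr1 /=; exact: hH.
rewrite big_ord_recl /= normrM normfV (ger0_norm (ltW (a0 _))).
have h y := IH _ y (fun i => a0 i.+1) (cvg_series_shift ca).
rewrite invfM [(a _)^-1 * _]mulrC mulrA ler_pM2r ?invr_gt0//.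
apply: le_trans (ler_normB _ _) _; apply: le_trans (lerD (h _) (h _)) _.
by rewrite exprS le_eqVlt; apply/orP; left; apply/eqP; ring.
Qed.

End InfiniteAverage.

Lemma smooth_bump_of_summable (R : realType) (a : nat -> R) :
  (forall i, 0 < a i) -> cvgn (series a) ->
  exists (phi : nat -> R -> R) (H B : R),
  [/\ forall k (x : R), is_derive x 1 (phi k) (phi k.+1 x),
      forall x, B < `|x| -> phi 0%N x = 0,
      exists x, phi 0%N x != 0 &
      forall k x, `|phi k x| <= H * 2 ^+ k / \prod_(i < k) a i].
Proof.
move=> a0 ca; pose S := limn (series a).
have S0 : 0 <= S.
  apply: limr_ge => //; near=> n; apply: sumr_ge0 => i _; exact: ltW.
(* With this height the tent is at least 1 on [[H - S, H]], the only interval that matters for the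
   average at [H]. *)
pose H := S + 1; have H0 : 0 <= H by rewrite /H; lra.
have hg := tent_lipschitz H0.
have tent01 y : 0 <= tent H y <= H.
  by rewrite /tent le_max lexx /= ge_max H0 /= gerBl normr_ge0.
(* The tent lives on [[0, H + H]], and averaging extends its support to the right by at most [S]. *)
exists (fun k => infinite_average_deriv (tent H) k a), H, (H + H + S); split.
- by move=> k x; exact: is_derive_infinite_average_deriv.
- move=> x xB; apply/eqP; rewrite eq_le andbC /=.
  apply: infinite_average_range => // y /andP[y1 y2].
  suff -> : tent H y = 0 by rewrite lexx.
  apply/max_idPl; rewrite subr_le0.
  move: xB; case: (leP 0 x) => x0 xB.
    move: xB; rewrite (ger0_norm x0) => xB.
    by apply: le_trans (ler_norm _); rewrite -/S in y1; lra.
  by rewrite distrC; apply: le_trans (ler_norm _); lra.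
- exists H; rewrite gt_eqF//; apply: (@lt_le_trans _ _ 1) => //.
  suff /andP[] : 1 <= infinite_average (tent H) a H <= H by [].
  apply: infinite_average_range => // y /andP[y1 y2].
  have /andP[_ ->] := tent01 y; rewrite andbT /tent le_max; apply/orP; right.
  by rewrite distrC ger0_norm ?subr_ge0// -/S in y1 *; rewrite /H in y1 y2 *; lra.
- move=> k x; apply: infinite_average_deriv_bound => // b y b0 cb.
  have /andP[h1 h2] : 0 <= infinite_average (tent H) b y <= H.
    exact: infinite_average_range.
  by rewrite ger0_norm.
Unshelve. all: by end_near. Qed.

(** * Slopes of the log-convex minorant *)

Section Slopes.
Variables (R : realType) (M : nat -> R).
Hypotheses (M0 : M 0%N = 1) (M1 : forall k, 1 <= M k).

(** By a min-max formula, the slope on [[k, k.+1]] of the convex minorant of the binary logarithm of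
    [M] is the infimum over [i > k] of the largest slope of a chord from some [j <= k] to [i]. *)
Definition slope_bound (k s : nat) : Prop :=
  exists2 i, (k < i)%N & forall j, (j <= k)%N -> M i <= 2 ^+ (s * (i - j)) * M j.

Lemma ex_slope k : exists s, `[< slope_bound k s >].
Proof.
have [n Mn] : exists n, M k.+1 <= 2 ^+ n.
  exists (Num.truncn (M k.+1)).+1.
  apply: le_trans (ltW (truncnS_gt _)) _.
  by rewrite -natrX ler_nat ltnW// ltn_expl.
exists n; apply/asboolP; exists k.+1 => // j jk.
apply: le_trans Mn _; apply: le_trans (_ : 2 ^+ (n * (k.+1 - j)) <= _).
  by rewrite ler_eXn2l ?ltr1n// leq_pmulr// subn_gt0.
by rewrite ler_peMr// exprn_ge0.
Qed.

(* 2 ^+ slope k approximates, up to a factor 2, the quotient of the terms k.+1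
   and k of the largest log-convex minorant of M. *)
Definition slope k : nat := ex_minn (ex_slope k).

Lemma slopeP k : slope_bound k (slope k).
Proof. by rewrite /slope; case: ex_minnP => s /asboolP. Qed.

Lemma slope_min k s : slope_bound k s -> (slope k <= s)%N.
Proof. by rewrite /slope; case: ex_minnP => s' _ h /asboolP /h. Qed.

Lemma slope_ndecr : {homo slope : k l / (k <= l)%N}.
Proof.
apply: homo_leq => [//|y x z|k]; first exact: leq_trans.
apply: slope_min; have [i ki Hi] := slopeP k.+1.
by exists i; [exact: ltnW|move=> j jk; apply: Hi; exact: leqW].
Qed.

Definition slope_prod k : R := \prod_(l < k) 2 ^+ slope l.

Lemma slope_prodS k : slope_prod k.+1 = slope_prod k * 2 ^+ slope k.
Proof. by rewrite /slope_prod big_ord_recr. Qed.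

Lemma slope_prod_gt0 k : 0 < slope_prod k.
Proof. by apply: prodr_gt0 => i _; rewrite exprn_gt0. Qed.

Lemma slope_prod_mul k m s : (forall l, (k <= l < k + m)%N -> (slope l <= s)%N) ->
  slope_prod (k + m) <= slope_prod k * 2 ^+ (s * m).
Proof.
elim: m => [|m IH] H; first by rewrite addn0 muln0 mulr1.
rewrite addnS slope_prodS mulnSr exprD mulrA; apply: ler_pM.
- exact/ltW/slope_prod_gt0.
- exact: exprn_ge0.
- by apply: IH => l /andP[h1 h2]; apply: H; rewrite h1 addnS leqW.
- by rewrite ler_eXn2l ?ltr1n//; apply: H; rewrite leq_addr addnS /=.
Qed.

Lemma slope_prod_mul_const k m s : (forall l, (k <= l < k + m)%N -> slope l = s) ->
  slope_prod (k + m) = slope_prod k * 2 ^+ (s * m).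
Proof.
elim: m => [|m IH] H; first by rewrite addn0 muln0 mulr1.
rewrite addnS slope_prodS mulnSr exprD mulrA IH.
  by rewrite H// leq_addr addnS /=.
by move=> l /andP[h1 h2]; apply: H; rewrite h1 addnS leqW.
Qed.

(** Rounding slopes up to integers loses at most a factor 2 per index, whence [2 ^+ k]. *)
Lemma slope_prod_le k : slope_prod k <= 2 ^+ k * M k.
Proof.
elim/ltn_ind: k => -[_|k IH]; first by rewrite /slope_prod big_ord0 mul1r M0.
case Es : (slope k) => [|s].
  have := @slope_prod_mul 0%N k.+1 0%N; rewrite add0n mul0n /slope_prod big_ord0 mulr1.
  move=> H; apply: le_trans (H _) _ => [l|].
    by rewrite ltnS => /= /slope_ndecr; rewrite Es.
  by rewrite -[leLHS]mulr1; apply: ler_pM => //; rewrite exprn_ege1// ler1n.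
(* By minimality of [slope k], the chord test with right end [k.+1] fails for [s]. The slopes from
   [j] to [k] are at most [s.+1], so this costs one factor 2 for each of these indices. *)
have [j jk Mj] : exists2 j, (j <= k)%N & 2 ^+ (s * (k.+1 - j)) * M j < M k.+1.
  apply: contrapT => H; have : slope_bound k s.
    by exists k.+1 => // j jk; rewrite leNgt; apply/negP => h; apply: H; exists j.
  by move/slope_min; rewrite Es ltnn.
have jk1 : (j <= k.+1)%N by exact: leqW.
have := @slope_prod_mul j (k.+1 - j) s.+1.
rewrite subnKC// => H; apply: le_trans (H _) _ => [l /andP[_]|].
  by rewrite ltnS => /slope_ndecr; rewrite Es.
have h := IH _ jk.
apply: le_trans (ler_wpM2r _ h) _; first exact: exprn_ge0.
have -> : 2 ^+ k.+1 = 2 ^+ j * 2 ^+ (k.+1 - j) :> R by rewrite -exprD subnKC.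
rewrite mulSn exprD -!mulrA ler_wpM2l ?exprn_ge0//.
by rewrite mulrCA ler_wpM2l ?exprn_ge0// mulrC; exact: ltW.
Qed.

(* The indices at which the log-convex minorant touches M. *)
Definition good k := M k <= slope_prod k.

Lemma good_mul p q s : (p <= q)%N -> good p -> M q <= 2 ^+ (s * (q - p)) * M p ->
  (forall l, (p <= l < q)%N -> slope l = s) -> good q.
Proof.
move=> pq gp Mq H; rewrite /good -(subnKC pq) (@slope_prod_mul_const _ _ s).
  by rewrite subnKC// (le_trans Mq)// mulrC ler_wpM2r// exprn_ge0.
by rewrite subnKC.
Qed.

(** A new block opens only where the slope jumps, and the minorant touches [M] at each such
    corner. *)
Lemma good_block q : exists2 p, (p <= q)%N &
  good p /\ forall l, (p <= l <= q)%N -> slope l = slope q.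
Proof.
elim: q => [|q [p pq [gp Hp]]].
  exists 0%N => //; split; first by rewrite /good M0 /slope_prod big_ord0.
  by move=> l; rewrite leqn0 => /eqP ->.
have := slope_ndecr (leqnSn q); rewrite leq_eqVlt => /orP[/eqP E|lt].
  exists p; first exact: leqW.
  split=> // l /andP[pl]; rewrite leq_eqVlt => /orP[/eqP -> //|]; rewrite ltnS => lq.
  by rewrite -E; apply: Hp; rewrite pl.
exists q.+1 => //; split; last by move=> l; rewrite -eqn_leq => /eqP ->.
apply: (@good_mul p _ (slope q)) => //; first exact: leqW.
have [i qi Hi] := slopeP q.
move: (qi); rewrite leq_eqVlt => /orP[/eqP E|qi1]; first by rewrite E; exact: Hi.
(* Because of the jump, [i] fails the test at [q.+1], and only [j = q.+1] can be responsible.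
   Comparing with the chord from [p] to [i] bounds [M q.+1] by the line of slope [slope q] through
   [p]. *)
have [j jq Mj] : exists2 j, (j <= q.+1)%N & 2 ^+ (slope q * (i - j)) * M j < M i.
  apply: contrapT => H; have : slope_bound q.+1 (slope q).
    by exists i => // j jk; rewrite leNgt; apply/negP => h; apply: H; exists j.
  by move/slope_min; rewrite leqNgt lt.
move: jq Mj; rewrite leq_eqVlt => /orP[/eqP ->|jq]; last by rewrite ltNge Hi.
move=> Mj; have := lt_le_trans Mj (Hi _ pq).
have -> : (i - p = (i - q.+1) + (q.+1 - p))%N by rewrite addnBA ?subnK// leqW.
by rewrite mulnDr exprD -mulrA ltr_pM2l ?exprn_gt0// => /ltW.
Qed.

Lemma good_jump q : (slope q < slope q.+1)%N -> good q.+1.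
Proof.
move=> lt; have [p] := good_block q.+1.
rewrite leq_eqVlt => /orP[/eqP -> [] //|]; rewrite ltnS => pq [_ /(_ q)].
by rewrite pq leqnSn => /(_ isT) E; move: lt; rewrite E ltnn.
Qed.

Lemma slope_no_good n q : (forall k, (n < k <= q)%N -> ~ good k) ->
  (n <= q)%N -> slope q = slope n.
Proof.
elim: q => [|q IH] H; first by rewrite leqn0 => /eqP ->.
rewrite leq_eqVlt => /orP[/eqP -> //|]; rewrite ltnS => nq.
rewrite -IH//; last by move=> k /andP[h1 h2]; apply: H; rewrite h1 leqW.
apply/eqP; rewrite eqn_leq (slope_ndecr (leqnSn q)) andbT leqNgt.
by apply/negP => /good_jump; apply: H; rewrite leqnn ltnS nq.
Qed.

(** Without good indices from [n] on, the slope would be constant there, and the index realizing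
    [slope_bound n] would itself be good. *)
Lemma good_unbounded n : exists2 m, (n <= m)%N & good m.
Proof.
apply: contrapT => H.
have E q : (n <= q)%N -> slope q = slope n.
  by apply: slope_no_good => k /andP[nk _] gk; apply: H; exists k => //; exact: ltnW.
have [p pn [gp Hp]] := good_block n.
have [i ni Hi] := slopeP n.
apply: H; exists i; first exact: ltnW.
apply: (@good_mul p _ (slope n)) => //; [|exact: Hi|].
  by apply: ltnW; exact: leq_ltn_trans ni.
move=> l /andP[pl li]; case: (leqP n l) => [/E //|ln].
by apply: Hp; rewrite pl ltnW.
Qed.

End Slopes.

(** * Bang's theorem *)

Section Bang.
Variable R : realType.

Lemma nondecreasing_of_derive (F f : R -> R) (x y : R) : x <= y ->
  (forall z : R, is_derive z 1 F (f z)) ->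
  (forall z, x <= z <= y -> 0 <= f z) -> F x <= F y.
Proof.
move=> xy dF f0.
have [c] := MVT_segment xy (fun z _ => dF z)
  (continuous_subspaceT (is_derive_continuous dF)).
rewrite in_itv /= => /f0 fc E; rewrite -subr_ge0 E mulr_ge0// subr_ge0//.
Qed.

Lemma is_derive_expR_affine (b x z : R) :
  is_derive z 1 (fun y => expR (b * (y - x))) (b * expR (b * (z - x))).
Proof.
have d1 : is_derive z 1 (fun y : R => b * (y - x)) b.
  have := is_deriveZ b (is_derive_shift z 1 (- x)).
  by rewrite /GRing.scale /= mulr1.
rewrite mulrC; exact: (@is_derive1_comp R expR _ z _ _ (is_derive_expR _) d1).
Qed.

Variables (M : nat -> R) (g : nat -> R -> R).
Hypotheses (M0 : M 0%N = 1) (M1 : forall k, 1 <= M k).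
Hypothesis dg : forall k (y : R), is_derive y 1 (g k) (g k.+1 y).

Local Notation W := (slope_prod M1).
Local Notation t := (slope M1).
Local Notation E := (expR 1 : R).

Let weight_ge0 (A h : R) i j : 0 <= A -> 0 <= h ->
  0 <= A * E ^+ j * (h ^+ i * W i).
Proof.
move=> A0 h0; apply: mulr_ge0; apply: mulr_ge0; rewrite ?exprn_ge0 ?expR_ge0//.
exact/ltW/slope_prod_gt0.
Qed.

(* The hypothesis on [g q] propagates downward: the right-hand side of the
   conclusion for [j] has derivative at least the one for [j.+1]. *)
Lemma derivative_majorant (A h x y : R) (q s : nat) : 0 <= A -> 0 < h ->
  (forall l, (l < q)%N -> (t l <= s)%N) ->
  (forall z, x <= z <= y -> `|g q z| <= A * E ^+ q * (h ^+ q * W q)) ->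
  (forall j, (j < q)%N -> `|g j x| <= A * E ^+ j * (h ^+ j * W j)) ->
  forall j z, (j <= q)%N -> x <= z <= y ->
    `|g j z| <= A * E ^+ j * (h ^+ j * W j) * expR (E * h * 2 ^+ s * (z - x)).
Proof.
move=> A0 h0 ts gq gx j z jq; move: z.
have B0 i : 0 <= A * E ^+ i * (h ^+ i * W i).
  by apply: weight_ge0 => //; exact: ltW.
(* [lam] is the ratio of consecutive majorants, with [2 ^+ t j] replaced by its upper bound
   [2 ^+ s]. *)
set lam := E * h * 2 ^+ s.
have lam0 : 0 <= lam by rewrite !mulr_ge0 ?exprn_ge0 ?expR_ge0 ?ltW.
rewrite -(subKn jq); elim: (q - j)%N (leq_subr j q) => {j jq} [_|d IH dq] z xz.
  rewrite subn0; apply: le_trans (gq _ xz) _.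
  rewrite ler_peMr// -expR0 ler_expR mulr_ge0// subr_ge0.
  by case/andP: xz.
have := IH (ltnW dq); rewrite -(subnSK dq); set j := (q - d.+1)%N => {}IH.
have jq : (j < q)%N by rewrite /j subnSK// leq_subr.
set B := A * E ^+ j * (h ^+ j * W j).
have bound u : x <= u <= y -> `|g j.+1 u| <= B * (lam * expR (lam * (u - x))).
  move=> /IH; move/le_trans; apply; rewrite [leRHS]mulrA ler_wpM2r ?expR_ge0//.
  rewrite slope_prodS !exprS /B /lam.
  have -> : A * (E * E ^+ j) * (h * h ^+ j * (W j * 2 ^+ t j)) =
    A * E ^+ j * (h ^+ j * W j) * (E * h) * 2 ^+ t j by ring.
  rewrite [leRHS]mulrA; apply: ler_wpM2l; last by rewrite ler_eXn2l ?ltr1n// ts.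
  by rewrite mulr_ge0 ?B0// mulr_ge0 ?expR_ge0// ltW.
have [x_z zy] := andP xz.
have dE u := is_deriveZ B (is_derive_expR_affine lam x u).
have step u : x <= u <= z -> `|g j.+1 u| <= B * (lam * expR (lam * (u - x))).
  by move=> /andP[u1 u2]; apply: bound; rewrite u1 (le_trans u2).
have := gx _ jq; rewrite -/B !ler_norml => /andP[gx1 gx2]; apply/andP; split.
  (* Adding [g j] to the majorant, or subtracting it, gives a nondecreasing function. *)
  have : B * expR (lam * (x - x)) + g j x <= B * expR (lam * (z - x)) + g j z.
    apply: (nondecreasing_of_derive x_z (fun u => is_deriveD (dE u) (dg j u))) => u.
    by move=> /step; rewrite ler_norml => /andP[+ _]; rewrite -lerBlDl sub0r.
  by rewrite subrr mulr0 expR0; lra.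
have : B * expR (lam * (x - x)) - g j x <= B * expR (lam * (z - x)) - g j z.
  apply: (nondecreasing_of_derive x_z (fun u => is_deriveB (dE u) (dg j u))) => u.
  by move=> /step; rewrite ler_norml subr_ge0 => /andP[_].
by rewrite subrr mulr0 expR0; lra.
Qed.

(* Downward induction on n: to pass from n.+1 to n, derivative_majorant is applied
   with q the least good index above n; slope is constant from n to q - 1, and no
   bound is needed on the derivatives of order strictly between n and q. *)
Lemma flat_derivative_bound (C h x0 x1 : R) (m n : nat) :
  0 <= C -> 0 < h -> good M1 m -> (n <= m)%N ->
  (forall k y, x0 <= y <= x1 -> `|g k y| <= C * (h ^+ k * M k)) ->
  (forall k, g k x0 = 0) ->
  forall y, x0 <= y <= x1 ->
    y <= x0 + (\sum_(n <= l < m) (2 ^+ t l)^-1) / (E * h) ->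
  forall j, (forall k, (n <= k <= j)%N -> ~ good M1 k) ->
    `|g j y| <= C / E ^+ n * E ^+ j * (h ^+ j * W j).
Proof.
move=> C0 h0 gm nm bd g0.
have E0 : 0 < E by exact: expR_gt0.
have E1 : 1 <= E by rewrite -expR0 ler_expR.
have A0 k : 0 <= C / E ^+ k by rewrite divr_ge0// exprn_ge0// ltW.
rewrite -(subKn nm); elim: (m - n)%N (leq_subr n m) => {n nm} [_|d IH dm] y yx.
  rewrite subn0 big_geq// mul0r addr0 => yx0 j _.
  have -> : y = x0 by apply/le_anti; rewrite yx0; case/andP: yx.
  by rewrite g0 normr0 weight_ge0 ?A0// ltW.
have := IH (ltnW dm); rewrite -(subnSK dm); set n := (m - d.+1)%N => {}IH.
have nm : (n < m)%N by rewrite /n subnSK// leq_subr.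
rewrite big_ltn//; set D := \sum_(n.+1 <= l < m) _ => yD j jgood.
have An : C / E ^+ n.+1 * E = C / E ^+ n.
  by rewrite exprSr invfM -!mulrA mulVf ?gt_eqF// mulr1.
(* Points already reached for [n.+1] satisfy a bound that is better by a factor [E]. *)
have [yx'|yx'] := leP y (x0 + D / (E * h)).
  apply: le_trans (IH _ yx yx' _ _) _.
    by move=> k /andP[nk kj]; apply: jgood; rewrite kj ltnW.
  rewrite -An.
  have -> : C / E ^+ n.+1 * E * E ^+ j * (h ^+ j * W j) =
    C / E ^+ n.+1 * E ^+ j * (h ^+ j * W j) * E by ring.
  by rewrite ler_peMr// weight_ge0// ltW.
have D0 : 0 <= D.
  by apply: sumr_ge0 => l _; rewrite invr_ge0 exprn_ge0.
set x := x0 + D / (E * h).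
have x0x : x0 <= x by rewrite /x lerDl divr_ge0// mulr_ge0 ?ltW.
have [x0y yx1] := andP yx.
have [q nq qP] : exists2 q, (n < q)%N &
    good M1 q /\ forall k, (n < k < q)%N -> ~ good M1 k.
  have exq : exists q, `[< (n < q)%N /\ good M1 q >] by exists m; apply/asboolP.
  case: (ex_minnP exq) => q /asboolP[nq gq] qmin; exists q => //.
  split=> // k /andP[nk kq] gk.
  by move: kq; rewrite ltnNge qmin//; apply/asboolP.
have jq : (j < q)%N.
  rewrite ltnNge; apply/negP => qj; apply: (jgood q) qP.1.
  by rewrite qj ltnW.
have tq l : (l < q)%N -> (t l <= t n)%N.
  move=> lq; have [ln|nl] := leqP l n; first exact: slope_ndecr.
  rewrite (slope_no_good M0 _ (ltnW nl))// => k /andP[nk kl].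
  by apply: qP.2; rewrite nk (leq_ltn_trans kl).
have := @derivative_majorant (C / E ^+ n.+1) h x y q (t n) (A0 _) h0 tq.
move=> /(_ _ _ j y (ltnW jq)) H; apply: le_trans (H _ _ _) _.
(* At [q] the given bound in terms of [M] suffices: [M q <= W q] as [q] is good, and
   [E ^+ q / E ^+ n.+1] is at least 1 as [n < q]. *)
- move=> z /andP[xz zy]; apply: le_trans (bd q z _) _.
    by rewrite (le_trans x0x xz) (le_trans zy yx1).
  have Eqn : 1 <= E ^+ q / E ^+ n.+1.
    by rewrite ler_pdivlMr ?exprn_gt0// mul1r ler_weXn2l.
  have -> : C / E ^+ n.+1 * E ^+ q * (h ^+ q * W q) =
    C * (E ^+ q / E ^+ n.+1) * (h ^+ q * W q) by ring.
  apply: ler_pM => //; first by rewrite mulr_ge0 ?exprn_ge0 ?(ltW h0)// (le_trans _ (M1 q)).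
    by rewrite ler_peMr.
  by rewrite ler_wpM2l ?exprn_ge0 ?(ltW h0)//; exact: qP.1.
- move=> i iq; apply: IH; rewrite ?lexx ?x0x ?(ltW (lt_le_trans yx' yx1))//.
  by move=> k /andP[nk ki]; apply: qP.2; rewrite nk (leq_ltn_trans ki).
- by rewrite lexx ltW.
rewrite -An.
have -> : C / E ^+ n.+1 * E * E ^+ j * (h ^+ j * W j) =
  C / E ^+ n.+1 * E ^+ j * (h ^+ j * W j) * E by ring.
apply: ler_wpM2l; first by apply: weight_ge0 => //; exact: ltW.
rewrite ler_expR.
(* The remaining distance is chosen so that the exponential factor is at most [E]. *)
have : y - x <= (2 ^+ t n)^-1 / (E * h).
  by rewrite lerBlDr /x addrCA -mulrDl.
rewrite ler_pdivlMr ?mulr_gt0// -(ler_pM2l (_ : 0 < 2 ^+ t n)) ?exprn_gt0//.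
rewrite divff ?expf_neq0// => H1.
by apply: le_trans H1; rewrite le_eqVlt; apply/orP; left; apply/eqP; ring.
Qed.

Theorem non_quasianalytic_summable (C h x0 x1 : R) :
  0 < h -> x0 <= x1 ->
  (forall k y, x0 <= y <= x1 -> `|g k y| <= C * (h ^+ k * M k)) ->
  (forall k, g k x0 = 0) -> g 0%N x1 != 0 ->
  cvgn (series (fun l => (2 ^+ t l)^-1 : R)).
Proof.
move=> h0 x01 bd g0 gx1.
have C0 : 0 <= C.
  have := bd 0%N x1; rewrite x01 lexx M0 expr0 !mulr1 => /(_ isT).
  exact: le_trans.
have mono : {homo series (fun l => (2 ^+ t l)^-1 : R) : n m / (n <= m)%N >-> n <= m}.
  by apply: nondecreasing_series => *; rewrite invr_ge0 exprn_ge0.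
apply: contrapT => div.
have unb (B : R) : exists m, B < series (fun l => (2 ^+ t l)^-1) m.
  apply: contrapT => H; apply: div; apply: nondecreasing_is_cvgn => //.
  by exists B => _ [m _ <-]; rewrite leNgt; apply/negP => hm; apply: H; exists m.
(* For [n > 0] no index [k] satisfies [n <= k <= 0], so the condition on good indices is vacuous for
   [j = 0]. *)
have small n : (0 < n)%N -> `|g 0%N x1| <= C / E ^+ n.
  move=> n0.
  (* The terms after the first [n] must add up to enough to travel from [x0] to [x1]. *)
  have [m0 Hm0] := unb (series (fun l => (2 ^+ t l)^-1) n + (x1 - x0) * (E * h)).
  have [m mm gm] := good_unbounded M0 M1 (maxn m0 n).
  have /andP[m0m nm] : (m0 <= m)%N && (n <= m)%N by rewrite -geq_max.
  have := @flat_derivative_bound C h x0 x1 m n C0 h0 gm nm bd g0 x1.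
  rewrite x01 lexx => /(_ isT _ 0%N).
  rewrite !expr0 !mulr1 !mul1r /slope_prod big_ord0 mulr1; apply.
    rewrite -lerBlDl ler_pdivlMr ?mulr_gt0 ?expR_gt0//.
    have := mono _ _ m0m.
    rewrite {2}/series /= (big_cat_nat (n := n))//=.
    rewrite -[X in _ <= X + _ -> _]/(series (fun l => (2 ^+ t l)^-1) n).
    by move: Hm0; lra.
  by move=> k /andP[nk]; rewrite leqn0 => /eqP k0; move: nk; rewrite k0 leqNgt n0.
have gp : 0 < `|g 0%N x1| by rewrite normr_gt0.
(* [E ^+ n] is at least [1 + n], which exceeds the quotient of [C] by the value at [x1]. *)
pose n := (Num.truncn (C / `|g 0%N x1|)).+1.
have := small n isT; apply/negP; rewrite -ltNge.
rewrite ltr_pdivrMr ?exprn_gt0 ?expR_gt0// mulrC -ltr_pdivrMr//.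
apply: lt_le_trans (truncnS_gt _) _; rewrite -/n -expRM_natl mulr1.
by apply: le_trans (expR_ge1Dx _); rewrite lerDr.
Qed.

End Bang.

(** * Ultradifferentiable norms *)

Section UltraNorm.
Variables (R : realType) (r : nat).
Implicit Types (f : 'rV[R]_r -> R) (K : set 'rV[R]_r) (M : nat -> R).

Lemma ultra_norm_ub M K (h : R) f : 0 < h -> (forall k, 0 < M k) ->
  (ultra_norm M K h f < +oo)%E ->
  exists C : R, forall x vs, K x -> (forall v, v \in vs -> euclidean_norm v <= 1) ->
    `|frechet f vs x| <= C * (h ^+ size vs * M (size vs)).
Proof.
move=> h0 M0 fin.
have [C HC] : exists C : R, (ultra_norm M K h f <= C%:E)%E.
  move: fin; case: (ultra_norm _ _ _ _) => [c| |] // _; first by exists c.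
  (* The value [-oo], taken for empty [K], lies below any constant. *)
  by exists 0; rewrite leNye.
exists C => x vs Kx vs1.
have hM : 0 < h ^+ size vs * M (size vs) by rewrite mulr_gt0// exprn_gt0.
rewrite -ler_pdivrMr// -lee_fin EFinM; apply: le_trans HC.
apply: le_ereal_sup_tmp.
exists (operator_norm (fun v : (size vs).-tuple _ => frechet f v x)
          * ((h ^+ size vs * M (size vs))^-1)%:E)%E.
  by exists (size vs) => //; exists x.
apply: lee_wpmul2r; first by rewrite lee_fin invr_ge0 ltW.
apply: le_ereal_sup_tmp; exists (`|frechet f vs x|%:E) => //.
by exists (in_tuple vs) => //= i; apply: vs1; exact: mem_tnth.
Qed.

Lemma ultra_norm_lty M K (h C : R) f : 0 < h -> (forall k, 0 < M k) ->
  (forall x vs, K x -> (forall v, v \in vs -> euclidean_norm v <= 1) ->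
    `|frechet f vs x| <= C * (h ^+ size vs * M (size vs))) ->
  (ultra_norm M K h f < +oo)%E.
Proof.
move=> h0 M0 H; apply: (@le_lt_trans _ _ C%:E); last exact: ltry.
apply/ereal_supP => _ [k _ [x Kx <-]].
have hM : 0 < h ^+ k * M k by rewrite mulr_gt0// exprn_gt0.
apply: (@le_trans _ _ ((C * (h ^+ k * M k))%:E * ((h ^+ k * M k)^-1)%:E)%E).
  apply: lee_wpmul2r; first by rewrite lee_fin invr_ge0 ltW.
  apply/ereal_supP => _ [v v1 <-]; rewrite lee_fin.
  have := H x v Kx; rewrite size_tuple; apply=> w /tnthP[i ->]; exact: v1.
by rewrite -EFinM mulfK ?gt_eqF.
Qed.

Lemma ler_norm_coord (v : 'rV[R]_r) i : `|v 0 i| <= `|v|.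
Proof.
have /mapP[j Hj ->] : `|v ord0 i| \in [seq `|v x.1 x.2| | x : 'I_1 * 'I_r].
  by apply/mapP; exists (ord0, i) => //=; rewrite mem_enum.
by rewrite [leRHS]/Num.norm /= mx_normrE; apply/bigmax_geP; right => /=; exists j.
Qed.

Lemma ler_euclidean_coord (v : 'rV[R]_r) i : `|v 0 i| <= euclidean_norm v.
Proof.
rewrite -sqrtr_sqr ler_wsqrtr// (bigD1 i)//= lerDl.
by apply: sumr_ge0 => j _; exact: sqr_ge0.
Qed.

Lemma beurling_roumieu M U f : beurling M U f -> roumieu M U f.
Proof. by move=> [fs H]; split=> // K cK KU; exists 1 => //; exact: H. Qed.

End UltraNorm.

(** * Restriction of compactly supported functions to a line *)

Lemma is_derive_line (R : realType) (V : normedModType R) (F : V -> R)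
    (p e : V) (s : R) : differentiable F (p + s *: e) ->
  is_derive s 1 (fun s : R => F (p + s *: e)) ('d F (p + s *: e) e).
Proof.
move=> dF.
have dl : is_diff s (cst p + ( *:%R^~ e)) (0 + ( *:%R^~ e)) by exact: is_diffD.
have dFl : differentiable (F \o (cst p + ( *:%R^~ e))) s by exact: differentiable_comp.
apply: DeriveDef; first exact: diff_derivable.
rewrite deriveE// -[fun s => _]/(F \o (cst p + ( *:%R^~ e))) diff_comp//=.
by rewrite diff_val /= add0r scale1r.
Qed.

Lemma locally_zero_derivatives (R : realType) (g : nat -> R -> R) (b : R) :
  (forall k (y : R), is_derive y 1 (g k) (g k.+1 y)) ->
  (forall y, y < b -> g 0%N y = 0) -> forall k y, y < b -> g k y = 0.
Proof.
move=> dg g0; elim=> // k IH y yb.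
have d0 : is_derive y 1 (g k) 0.
  apply: near_eq_is_derive (is_derive_cst (0 : R) y (1 : R)).
  near=> z; rewrite IH//; near: z; exact: lt_nbhsl.
by rewrite -(@derive_val _ _ _ _ _ _ _ (dg k y)) (@derive_val _ _ _ _ _ _ _ d0).
Unshelve. all: by end_near. Qed.

(** [K] is chosen before [M] and [h]: a function in a Roumieu matrix class then selects one weight,
    the one attached to this [K]. *)
Lemma compact_support_slope_summable (R : realType) (r : nat) (f : 'rV[R]_r.+1 -> R) :
  smooth_on setT f -> compact (closure [set x | f x != 0]) ->
  (exists x, f x != 0) ->
  exists2 K, compact K & forall (M : nat -> R) (h : R)
    (M0 : M 0%N = 1) (M1 : forall k, 1 <= M k), 0 < h ->
    (ultra_norm M K h f < +oo)%E ->
    cvgn (series (fun l => (2 ^+ slope M1 l)^-1 : R)).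
Proof.
move=> fs cf [p fp].
have [B [_ /(_ (B + 1))]] := compact_bounded cf.
rewrite ltrDl ltr01 => /(_ isT); set B1 := B + 1 => HB.
pose e : 'rV[R]_r.+1 := delta_mx 0 0.
have e1 : euclidean_norm e <= 1.
  rewrite /euclidean_norm (bigD1 0)//= big1 ?addr0 => [|i i0].
    by rewrite mxE !eqxx expr1n sqrtr1.
  by rewrite mxE (negbTE i0) andbF expr0n.
(* For parameters below [b] the first coordinate on the line through [p] leaves the box containing
   the support. *)
pose b := - (B1 + `|p 0 0|).
have supp (s : R) : f (p + s *: e) != 0 -> b <= s.
  move=> fps; have /HB : closure [set x | f x != 0] (p + s *: e) by exact: subset_closure.
  have := ler_norm_coord (p + s *: e) 0; rewrite !mxE !eqxx mulr1 => h1 h2.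
  have := le_trans h1 h2; rewrite ler_norml => /andP[h3 _].
  by have := ler_norm (p 0 0); rewrite /b; lra.
have b0 : b <= 0 by apply: supp; rewrite scale0r addr0.
(* The left end of the segment is in the interior of the zero set along the line, so all derivatives
   vanish there; the right end is [p]. *)
pose K := [set p + s *: e | s in `[b - 1, 0]].
exists K.
  apply: continuous_compact; last exact: segment_compact.
  apply: continuous_subspaceT => s; apply: (@differentiable_continuous _ _ _ s).
  by have : is_diff s (cst p + ( *:%R^~ e)) (0 + ( *:%R^~ e)) by exact: is_diffD.
move=> M h M0 M1 h0 fin.
have Mpos k : 0 < M k by exact: lt_le_trans (M1 k).
have [C HC] := ultra_norm_ub h0 Mpos fin.
pose g k (s : R) := frechet f (nseq k e) (p + s *: e).
have dg k (s : R) : is_derive s 1 (g k) (g k.+1 s).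
  exact/is_derive_line/fs.
have g0 : forall y, y < b -> g 0%N y = 0.
  by move=> y; apply: contraTeq => /supp; rewrite -leNgt.
apply: (@non_quasianalytic_summable _ _ _ M0 M1 dg C h (b - 1) 0) => //.
- by lra.
- move=> k y yb; have := HC (p + y *: e) (nseq k e); rewrite size_nseq; apply.
    by exists y; rewrite //= in_itv.
  by move=> v /nseqP[->].
- by move=> k; apply: (locally_zero_derivatives dg g0); lra.
- by rewrite /g /= scale0r addr0.
Qed.

(** * One summable sequence for countably many convergent series *)

Section CommonSequence.
Variables (R : realType) (w : nat -> nat -> R).
Hypotheses (w0 : forall n k, 0 < w n k) (wS : forall n, cvgn (series (w n))).

Lemma series_tail (u : nat -> R) (e : R) : (forall k, 0 < u k) -> cvgn (series u) ->
  0 < e -> exists N, forall m, \sum_(N <= l < m) u l <= e.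
Proof.
move=> u0 cu e0; have := cu => /cvgrPdist_le/(_ e e0) [N _ HN]; exists N => m.
have [mN|Nm] := leqP m N; first by rewrite big_geq// ltW.
have := HN N (leqnn N); rewrite /= => h; have := le_trans (ler_norm _) h.
have h2 : series u m <= limn (series u).
  by apply: nondecreasing_cvgn_le cu _; apply: nondecreasing_series => *; exact: ltW.
have : series u m = series u N + \sum_(N <= l < m) u l.
  by rewrite /series /= -big_cat_nat// ltnW.
by lra.
Qed.

Lemma sum_half_le m : \sum_(0 <= l < m) (2^-1 : R) ^+ l <= 2.
Proof.
suff : \sum_(0 <= l < m) (2^-1 : R) ^+ l <= 2 - 2 * 2^-1 ^+ m.
  by move/le_trans; apply; rewrite gerBl mulr_ge0// exprn_ge0.
elim: m => [|m IH]; first by rewrite big_geq// expr0; lra.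
rewrite big_nat_recr//= exprS; move: IH; set u := _ ^+ m; lra.
Qed.

Lemma common_sequence : exists a : nat -> R,
  [/\ forall i, 0 < a i, cvgn (series a) &
      forall n, exists C, forall k, \prod_(i < k) (n.+1%:R * w n i / a i) <= C].
Proof.
have tail n : exists N, forall m, \sum_(N <= l < m) (n.+1%:R * w n l) <= 2^-1 ^+ n.
  apply: series_tail; last by rewrite exprn_gt0.
    by move=> k; rewrite mulr_gt0.
  exact: (@is_cvg_seriesZ _ (w n) n.+1%:R).
have [N HN] := choice tail.
(* Cutting off below [N n] leaves a total of at most [2^-1 ^+ n], so the double series converges. *)
pose c n l : R := if (N n <= l)%N then n.+1%:R * w n l else 0.
have c0 n l : 0 <= c n l by rewrite /c; case: ifP => // _; rewrite mulr_ge0// ltW.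
(* The geometric term keeps [a] positive. Only the finitely many [n <= l] enter, so each sequence
   contributes to all but finitely many terms. *)
pose a l := 2^-1 ^+ l + \sum_(0 <= n < l.+1) c n l.
have a0 l : 0 < a l.
  by rewrite /a ltr_pwDl ?exprn_gt0// sumr_ge0.
exists a; split=> //.
  apply: nondecreasing_is_cvgn.
    by apply: nondecreasing_series => *; exact: ltW.
  exists (2 + 2) => _ [m _ <-]; rewrite /series /= big_split /= lerD ?sum_half_le//.
  apply: le_trans (sum_half_le m).
  apply: (@le_trans _ _ (\sum_(0 <= l < m) \sum_(0 <= n < m) c n l)).
    apply: ler_sum_nat => l /andP[_ lm].
    by rewrite [leRHS](big_cat_nat (n := l.+1))//= lerDl sumr_ge0.
  rewrite exchange_big_nat /=; apply: ler_sum_nat => n _.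
  apply: le_trans (HN n m).
  have [mN|Nm] := leqP m (N n).
    rewrite big_nat_cond big1 ?[leRHS]big_geq// => l /andP[/andP[_ lm] _].
    by rewrite /c leqNgt (leq_trans lm mN).
  rewrite (big_cat_nat (n := N n)) ?(ltnW Nm)//= [X in X + _]big_nat_cond big1 ?add0r.
    by apply: ler_sum_nat => l /andP[Nl _]; rewrite /c Nl.
  by move=> l /andP[/andP[_ lN] _]; rewrite /c leqNgt lN.
move=> n; pose u k := \prod_(i < k) (n.+1%:R * w n i / a i).
have u0 k : 0 <= u k.
  by apply: prodr_ge0 => i _; rewrite divr_ge0// ?mulr_ge0// ltW.
(* From [K] on every factor is at most 1; the sum of the first products serves as a bound for their
   maximum. *)
pose K := maxn (N n) n; exists (\sum_(k < K.+1) u k) => k.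
have small j : (j < K.+1)%N -> u j <= \sum_(k < K.+1) u k.
  by move=> jK; rewrite (bigD1 (Ordinal jK))//= lerDl sumr_ge0.
elim: k => [|k IH]; first exact: (small 0%N).
have [kK|Kk] := ltnP k K; first exact: (small k.+1).
apply: le_trans IH; rewrite big_ord_recr /= ler_piMr ?u0//.
rewrite ler_pdivrMr// mul1r /a.
have nk : (n < k.+1)%N by rewrite ltnS (leq_trans _ Kk)// leq_maxr.
rewrite big_mkord (bigD1 (Ordinal nk))//= addrCA {1}/c.
rewrite (leq_trans _ Kk) ?leq_maxl// lerDl addr_ge0 ?exprn_ge0//.
by rewrite sumr_ge0.
Qed.

End CommonSequence.

(** * Tensor products of one-variable functions and their derivatives *)

Section TensorProduct.
Variables (R : realType) (r : nat) (phi : nat -> R -> R).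
Hypothesis dphi : forall k (y : R), is_derive y 1 (phi k) (phi k.+1 y).
Implicit Types (al : 'I_r -> nat) (x v : 'rV[R]_r).

Definition incr (i : 'I_r) al : 'I_r -> nat := fun j => (al j + (j == i))%N.

Definition tensor al x : R := \prod_(i < r) phi (al i) (x 0 i).

Lemma is_diff_coord_fun k i x :
  is_diff x (fun y => phi k (y 0 i)) (fun v => v 0 i * phi k.+1 (x 0 i)).
Proof.
pose pr (y : 'rV[R]_r) : R := y 0 i.
have dc : is_diff x pr pr.
  have @f : {linear 'rV[R]_r -> R}.
    by exists (fun y : 'rV[R]_r => y 0 i); do 2![eexists]; do ?[constructor];
      rewrite ?mxE// => ? *; rewrite ?mxE//; move=> ?; rewrite !mxE.
  have fc : continuous f.
    by move=> y; exact: (differentiable_continuous (differentiable_coord _ _ _)).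
  rewrite (_ : pr = f)//; apply: DiffDef; first exact: linear_differentiable.
  by rewrite diff_lin.
have dp : is_diff (pr x) (phi k) (fun t : R => t * phi k.+1 (pr x)).
  have dk := dphi k (pr x).
  apply: DiffDef; first exact/derivable1_diffP.
  by rewrite deriv1E// derive1E derive_val.
exact: is_diff_eq (is_diff_comp dc dp) _.
Qed.

Lemma is_diff_sum (I : Type) (l : seq I) (f df : I -> 'rV[R]_r -> R) x :
  (forall i, is_diff x (f i) (df i)) ->
  is_diff x (fun y => \sum_(i <- l) f i y) (fun v => \sum_(i <- l) df i v).
Proof.
move=> dfi; elim: l => [|i l IH].
  have -> : (fun y => \sum_(i <- [::]) f i y) = cst 0 by apply/funext => y; rewrite big_nil.
  have -> : (fun y => \sum_(i <- [::]) df i y) = 0 by apply/funext => y; rewrite big_nil.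
  exact: is_diff_cst.
have -> : (fun y => \sum_(j <- i :: l) f j y) = f i + (fun y => \sum_(j <- l) f j y).
  by apply/funext => y; rewrite big_cons.
have -> : (fun y => \sum_(j <- i :: l) df j y) = df i + (fun y => \sum_(j <- l) df j y).
  by apply/funext => y; rewrite big_cons.
exact: is_diffD.
Qed.

(** Lists allow induction on the Leibniz rule; without repetitions, [incr i] affects exactly one
    factor. *)
Lemma is_diff_tensor_seq (l : seq 'I_r) al x : uniq l ->
  is_diff x (fun y => \prod_(i <- l) phi (al i) (y 0 i))
    (fun v => \sum_(i <- l) v 0 i * \prod_(j <- l) phi (incr i al j) (x 0 j)).
Proof.
elim: l => [_|i l IH /= /andP[il ul]].
  rewrite (_ : (fun y => _) = cst 1); last by apply/funext => y; rewrite big_nil.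
  rewrite (_ : (fun v => _) = 0); last by apply/funext => y; rewrite big_nil.
  exact: is_diff_cst.
have -> : (fun y : 'rV[R]_r => \prod_(j <- i :: l) phi (al j) (y 0 j)) =
    (fun y : 'rV[R]_r => phi (al i) (y 0 i)) *
    (fun y : 'rV[R]_r => \prod_(j <- l) phi (al j) (y 0 j)).
  by apply/funext => y; rewrite big_cons.
apply: is_diff_eq (is_diffM (is_diff_coord_fun (al i) i x) (IH ul)) _.
apply/funext => v; rewrite !fctE big_cons addrC; congr (_ + _).
  rewrite big_cons {1}/incr eqxx addn1 /GRing.scale /= mulrC -mulrA; congr (_ * (_ * _)).
  apply: eq_big_seq => j jl; rewrite /incr (_ : (j == i) = false) ?addn0//.
  by apply/negbTE; apply: contraNneq il => <-.
rewrite /GRing.scale /= mulr_sumr; apply: eq_big_seq => j jl.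
rewrite big_cons mulrCA; congr (_ * (_ * _)).
rewrite /incr (_ : (i == j) = false) ?addn0//.
by apply/negbTE; apply: contraNneq il => ->.
Qed.

Lemma is_diff_tensor al x :
  is_diff x (tensor al) (fun v => \sum_(i < r) v 0 i * tensor (incr i al) x).
Proof. by apply: is_diff_tensor_seq; exact: index_enum_uniq. Qed.

(* A polynomial in the coordinates of [vs] instead of an iterated differential;
   each vector raises the multi-index [al]. *)
Fixpoint tensor_deriv (vs : seq 'rV[R]_r) al x : R :=
  if vs is v :: ws then \sum_(i < r) v 0 i * tensor_deriv ws (incr i al) x
  else tensor al x.

(** The new vector is outermost in [tensor_deriv], while differentiation acts on the innermost
    [tensor]; the sums are exchanged and the increments commute. *)
Lemma is_diff_tensor_deriv vs al x :
  is_diff x (tensor_deriv vs al) (fun v => tensor_deriv (v :: vs) al x).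
Proof.
elim: vs al => [|w vs IH] al /=; first exact: is_diff_tensor.
have dj (j : 'I_r) := is_diffZ (w 0 j) (IH (incr j al)).
apply: is_diff_eq (is_diff_sum (index_enum 'I_r) dj) _.
apply/funext => v /=.
rewrite [RHS](eq_bigr (fun i => \sum_(j < r)
    v 0 i * (w 0 j * tensor_deriv vs (incr j (incr i al)) x))); last first.
  by move=> i _; rewrite mulr_sumr.
rewrite exchange_big /=; apply: eq_bigr => j _.
rewrite -[LHS]/(w 0 j * \sum_(i < r) v 0 i * tensor_deriv vs (incr i (incr j al)) x).
rewrite mulr_sumr.
apply: eq_bigr => i _; rewrite mulrCA; congr (_ * (_ * tensor_deriv _ _ _)).
by apply/funext => k; rewrite /incr addnAC.
Qed.

Lemma frechet_tensor vs al : frechet (tensor al) vs = tensor_deriv vs al.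
Proof.
elim: vs => // v vs IH; apply/funext => x /=; rewrite IH.
by have d := is_diff_tensor_deriv vs al x; rewrite diff_val.
Qed.

Lemma smooth_tensor al : smooth_on setT (tensor al).
Proof.
by move=> vs x _; rewrite frechet_tensor; have := is_diff_tensor_deriv vs al x => -[].
Qed.

(** The derivative is a sum of [r ^ size vs] terms with coefficients at most 1, each of total order
    raised by [size vs]. *)
Lemma tensor_deriv_bound (Q : nat -> R) vs al x :
  (forall be, `|tensor be x| <= Q (\sum_(i < r) be i)%N) ->
  (forall v, v \in vs -> forall i, `|v 0 i| <= 1) ->
  `|tensor_deriv vs al x| <= r%:R ^+ size vs * Q (\sum_(i < r) al i + size vs)%N.
Proof.
move=> HQ; elim: vs al => [|v vs IH] al vs1; first by rewrite mul1r addn0.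
apply: le_trans (ler_norm_sum _ _ _) _.
apply: (@le_trans _ _ (\sum_(i < r)
    (r%:R ^+ size vs * Q (\sum_(i < r) al i + size (v :: vs))%N))); last first.
  by rewrite sumr_const card_ord /= exprS -mulrA [leRHS]mulr_natl.
apply: ler_sum => i _; rewrite normrM.
apply: (@le_trans _ _ `|tensor_deriv vs (incr i al) x|).
  by rewrite ler_piMl// vs1// mem_head.
apply: le_trans (IH _ _) _; first by move=> u uvs; apply: vs1; rewrite inE uvs orbT.
have -> : (\sum_(j < r) incr i al j = (\sum_(j < r) al j).+1)%N.
  rewrite /incr big_split /= -addn1; congr (_ + _)%N.
  by rewrite (bigD1 i)//= eqxx big1// => j /negbTE ->.
by rewrite addSnnS.
Qed.

End TensorProduct.

(** * Compactly supported functions in Beurling classes *)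

Lemma slope_prod_superadd (R : realType) (M : nat -> R) (M1 : forall k, 1 <= M k) k l :
  slope_prod M1 k * slope_prod M1 l <= slope_prod M1 (k + l).
Proof.
rewrite {3}/slope_prod big_split_ord /= ler_wpM2l//; first exact/ltW/slope_prod_gt0.
apply: ler_prod => i _; rewrite exprn_ge0//= ler_eXn2l ?ltr1n//.
by apply: slope_ndecr; exact: leq_addl.
Qed.

(** Log-convexity makes the weights supermultiplicative, so bounds in the separate coordinates
    combine into one in the total order. *)
Lemma slope_prod_sum (R : realType) (M : nat -> R) (M1 : forall k, 1 <= M k) r
    (be : 'I_r -> nat) :
  \prod_(i < r) slope_prod M1 (be i) <= slope_prod M1 (\sum_(i < r) be i)%N.
Proof.
elim/big_rec2 : _ => [|i n y _ IH]; first by rewrite /slope_prod big_ord0.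
apply: le_trans (slope_prod_superadd _ _ _).
by rewrite ler_wpM2l//; exact/ltW/slope_prod_gt0.
Qed.

Lemma compact_closure_box (R : realType) (r : nat) (B : R) (A : set 'rV[R]_r) :
  (forall (v : 'rV[R]_r) i, A v -> `|v 0 i| <= B) -> compact (closure A).
Proof.
move=> AB; pose box := [set v : 'rV[R]_r | forall i, `[- B, B]%classic (v ord0 i)].
have cbox : compact box.
  by apply: (@rV_compact _ _ (fun=> `[- B, B]%classic)) => i; exact: segment_compact.
apply: (subclosed_compact _ cbox); first exact: closed_closure.
rewrite [X in _ `<=` X](closure_id box).1; last first.
  exact: (compact_closed (@norm_hausdorff _ _) cbox).
by apply: closureS => v Av i; rewrite /= in_itv /= -ler_norml; exact: AB.
Qed.

(** The factor [4 * r] comes from the difference quotients (2), from [slope_prod_le] (2) and from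
    the coordinate expansion ([r]). A single [f] serves all [n], and the division by [n.+1] yields
    arbitrarily small radii. *)
Lemma exists_common_bump (R : realType) (r : nat) (M : nat -> nat -> R)
    (M0 : forall n, M n 0%N = 1) (M1 : forall n k, 1 <= M n k) :
  (forall n, cvgn (series (fun l => (2 ^+ slope (M1 n) l)^-1 : R))) ->
  exists f : 'rV[R]_r -> R,
  [/\ smooth_on setT f, compact (closure [set x | f x != 0]), exists x, f x != 0 &
      forall n, exists D, forall x vs,
        (forall v, v \in vs -> euclidean_norm v <= 1) ->
        `|frechet f vs x| <= D * ((4 * r%:R / n.+1%:R) ^+ size vs * M n (size vs))].
Proof.
move=> sM.
have [|a [a0 ca Ha]] := common_sequence _ sM.
  by move=> n k; rewrite invr_gt0 exprn_gt0.
have [phi [H [B [dphi phi0 [x1 phix1] bphi]]]] := smooth_bump_of_summable a0 ca.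
pose z := fun _ : 'I_r => 0%N; exists (tensor phi z); split.
- exact: smooth_tensor.
- apply: (@compact_closure_box _ _ B) => v i; apply: contraNT; rewrite -ltNge => Bv.
  by rewrite /tensor (bigD1 i)//= phi0// mul0r.
- exists (const_mx x1); apply/prodf_neq0 => i _.
  by rewrite mxE.
move=> n; have [C HC] := Ha n; set c : R := n.+1%:R in HC *.
have c0 : 0 < c by rewrite ltr0n.
have H0 : 0 <= H.
  by have := bphi 0%N x1; rewrite big_ord0 expr0 mulr1 divr1; exact: le_trans.
have C0 : 0 <= C by have := HC 0%N; rewrite big_ord0; exact: le_trans.
set W := slope_prod (M1 n).
have pa k : 0 < \prod_(i < k) a i by exact: prodr_gt0.
have bphi' k x : `|phi k x| <= H * C * (2 / c) ^+ k * W k.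
  apply: le_trans (bphi k x) _.
  have := HC k; rewrite !big_split /= !prodfV prodr_const card_ord -/(slope_prod (M1 n) k) -/W => h.
  have W0 : 0 < W k by exact: slope_prod_gt0.
  have : (\prod_(i < k) a i)^-1 <= C * W k / c ^+ k.
    by rewrite ler_pdivlMr ?exprn_gt0// -ler_pdivrMr// mulrAC mulrC mulrA mulrAC.
  move=> h2; apply: le_trans (ler_wpM2l _ h2) _; first by rewrite mulr_ge0// exprn_ge0.
  by rewrite expr_div_n le_eqVlt; apply/orP; left; apply/eqP; ring.
pose Q k := (H * C) ^+ r * ((4 / c) ^+ k * M n k).
have HQ be x : `|tensor phi be x| <= Q (\sum_(i < r) be i)%N.
  rewrite normr_prod; apply: (@le_trans _ _
      (\prod_(i < r) (H * C * (2 / c) ^+ be i * W (be i)))).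
    by apply: ler_prod => i _; rewrite normr_ge0 bphi'.
  have -> : \prod_(i < r) (H * C * (2 / c) ^+ be i * W (be i)) =
    \prod_(i < r) (H * C) * \prod_(i < r) (2 / c) ^+ be i * \prod_(i < r) W (be i).
    by rewrite -!big_split.
  rewrite prodr_const card_ord prodrXr /Q -mulrA ler_wpM2l//.
    by rewrite exprn_ge0// mulr_ge0.
  have -> : 4 / c = (2 / c) * 2 by ring.
  rewrite [in leRHS]exprMn -[leRHS]mulrA ler_wpM2l ?exprn_ge0 ?divr_ge0 ?(ltW c0)//.
  by apply: le_trans (slope_prod_sum _ _) _; exact: slope_prod_le.
exists ((H * C) ^+ r) => x vs vs1; rewrite frechet_tensor//.
apply: le_trans (tensor_deriv_bound _ (HQ^~ x) _) _.
  by move=> v /vs1 v1 i; exact: le_trans (ler_euclidean_coord _ _) v1.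
rewrite /z big1// add0n /Q le_eqVlt; apply/orP; left; apply/eqP.
by rewrite [4 * _ / _]mulrAC mulrC [(_ * r%:R) ^+ _]exprMn; ring.
Qed.

(** Arbitrarily large [n] with [M n] below [MM x] provide arbitrarily small radii. Both a constant
    sequence of weights and a coinitial one fit this form. *)
Lemma beurling_matrix_non_quasianalytic (R : realType) (r : nat) (L : Type)
    (MM : L -> nat -> R) (M : nat -> nat -> R)
    (M0 : forall n, M n 0%N = 1) (M1 : forall n k, 1 <= M n k) :
  (forall x k, 0 < MM x k) ->
  (forall x N, exists2 n, (N <= n)%N & forall k, M n k <= MM x k) ->
  (forall n, cvgn (series (fun l => (2 ^+ slope (M1 n) l)^-1 : R))) ->
  non_quasianalytic (@beurling_matrix R r L MM).
Proof.
move=> MMpos Hdom sM.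
have [f [fs fc fn Hf]] := exists_common_bump r M0 sM.
exists f; split=> //; split=> // K _ _ x h h0.
pose N := Num.truncn (4 * r%:R / h).
have [n Nn Mn] := Hdom x N; have [D HD] := Hf n.
have hn : 4 * r%:R / n.+1%:R <= h.
  rewrite ler_pdivrMr ?ltr0n// [leRHS]mulrC -ler_pdivrMr//.
  by apply: le_trans (ltW (truncnS_gt _)) _; rewrite ler_nat ltnS.
apply: (@ultra_norm_lty _ _ _ _ _ `|D|) => // y vs _ vs1.
apply: le_trans (HD y vs vs1) _.
have p0 : 0 <= 4 * r%:R / n.+1%:R :> R by rewrite divr_ge0// mulr_ge0.
have m0 : 0 <= M n (size vs) by exact: le_trans (M1 _ _).
apply: (@le_trans _ _ (`|D| * ((4 * r%:R / n.+1%:R) ^+ size vs * M n (size vs)))).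
  by rewrite ler_wpM2r ?ler_norm// mulr_ge0 ?exprn_ge0.
rewrite ler_wpM2l//; apply: ler_pM => //; rewrite ?exprn_ge0//.
by rewrite lerXn2r// nnegrE ltW.
Qed.

(** The space is a single point, so a nonzero constant has compact support. *)
Lemma beurling_matrix_non_quasianalytic0 (R : realType) (L : Type) (MM : L -> nat -> R) :
  (forall x k, 0 < MM x k) -> non_quasianalytic (@beurling_matrix R 0 L MM).
Proof.
move=> MMpos; exists (cst 1).
have fE v vs : frechet (cst (1 : R) : 'rV[R]_0 -> R) (v :: vs) = cst 0.
  elim: vs v => [|w vs IH] v; apply/funext => x; rewrite [LHS]/=.
    by rewrite diff_cst.
  by rewrite -/(frechet _ (w :: vs)) IH diff_cst.
split; last by exists 0; rewrite oner_neq0.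
  split=> [[|v vs] x _|K _ _ x h h0].
  - exact: differentiable_cst.
  - by rewrite fE; exact: differentiable_cst.
  apply: (@ultra_norm_lty _ _ _ _ _ (MM x 0%N)^-1) => // y [|v vs] _ _.
    by rewrite expr0 mul1r mulVf ?gt_eqF// normr1.
  by rewrite fE normr0 !mulr_ge0 ?invr_ge0 ?exprn_ge0// ltW.
by apply: (@compact_closure_box _ _ 0) => v [].
Qed.

(** * Comparison of the classes and the characterization *)

Lemma weight_matrix_ge1 (R : realType) d (L : porderType d) (M : L -> nat -> R) :
  weight_matrix M -> forall x k, 1 <= M x k.
Proof.
move=> wM x; elim=> [|k IH]; first by rewrite wm_norm0.
exact: le_trans IH (wm_incr wM _ _).
Qed.

Lemma roumieu_slope_summable (R : realType) (r : nat) (M : nat -> R)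
    (M1 : forall k, 1 <= M k) : M 0%N = 1 ->
  non_quasianalytic (@roumieu R r.+1 M) ->
  cvgn (series (fun l => (2 ^+ slope M1 l)^-1 : R)).
Proof.
move=> M0 [f [[fs fr] fc fn]].
have [K cK HK] := compact_support_slope_summable fs fc fn.
have [h h0 fin] := fr K cK (@subsetT _ K).
exact: HK fin.
Qed.

Lemma ultra_class_roumieu (R : realType) (r : nat) (M : nat -> R) c :
  non_quasianalytic (@ultra_class c R r M) -> non_quasianalytic (@roumieu R r M).
Proof.
case: c => // -[f [fb fc fn]]; exists f; split=> //; exact: beurling_roumieu.
Qed.

Lemma beurling_ultra_class (R : realType) (r : nat) (M : nat -> R) c :
  non_quasianalytic (@beurling R r M) -> non_quasianalytic (@ultra_class c R r M).
Proof.
case: c => // -[f [fb fc fn]]; exists f; split=> //; exact: beurling_roumieu.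
Qed.

Lemma beurling_of_beurling_matrix (R : realType) (r : nat) (L : Type)
    (MM : L -> nat -> R) (x : L) :
  non_quasianalytic (@beurling_matrix R r L MM) ->
  non_quasianalytic (@beurling R r (MM x)).
Proof.
move=> [f [[fs fb] fc fn]]; exists f; split=> //; split=> // K cK KU h h0.
exact: fb.
Qed.

Theorem theorem4p1 (R : realType) (r : nat) :
  (forall (d : Order.disp_t) (L : porderType d) (M : L -> nat -> R),
     weight_matrix M ->
     forall c : class_type,
       non_quasianalytic (@roumieu_matrix R r L M) <->
       exists x0 : L, non_quasianalytic (@ultra_class c R r (M x0)))
  /\
  (forall M : {posnum R} -> nat -> R,
     weight_matrix M ->
     forall c : class_type,
       non_quasianalytic (@beurling_matrix R r {posnum R} M) <->
       forall x : {posnum R}, non_quasianalytic (@ultra_class c R r (M x))).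
Proof.
split=> [d L M wM c|M wM c]; split.
- move=> [f [[fs fr] fc fn]].
  have [x0 hx0] : exists x0, r = 0%N \/
      cvgn (series (fun l => (2 ^+ slope (weight_matrix_ge1 wM x0) l)^-1 : R)).
    case: r f fs fr fc fn => [|r'] f fs fr fc fn.
      (* In dimension 0 any index will do; the empty compact set supplies one. *)
      by have [x0 _] := fr set0 compact0 (@sub0set _ _); exists x0; left.
    have [K cK HK] := compact_support_slope_summable fs fc fn.
    have [x0 [h h0 fin]] := fr K cK (@subsetT _ K).
    by exists x0; right; apply: HK fin => //; exact: wm_norm0.
  (* Summability gives a function in the smaller Beurling class, which settles both readings of [c].
     The weight is treated as a matrix over [unit], repeated infinitely often. *)
  exists x0; apply: beurling_ultra_class.
  apply: (@beurling_of_beurling_matrix _ _ unit (fun=> M x0) tt).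
  have Mpos (_ : unit) k : 0 < M x0 k by exact: wm_pos.
  case: hx0 => [->|sM]; first exact: beurling_matrix_non_quasianalytic0.
  apply: (@beurling_matrix_non_quasianalytic _ _ _ _ (fun=> M x0)
    (fun=> wm_norm0 wM x0) (fun=> weight_matrix_ge1 wM x0)) => // _ N.
  by exists N.
- move=> [x0 /ultra_class_roumieu [f [[fs fr] fc fn]]].
  exists f; split=> //; split=> // K cK KU.
  by exists x0; exact: fr.
- move=> H x; apply: beurling_ultra_class; exact: beurling_of_beurling_matrix H.
- move=> H; case: r H => [|r'] H.
    by apply: beurling_matrix_non_quasianalytic0; exact: wm_pos.
  (* The indices [1 / n.+1] are coinitial in the positive reals, so countably many weights control
     the whole matrix. *)
  have y0 n : 0 < (n.+1%:R^-1 : R) by rewrite invr_gt0.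
  pose y n : {posnum R} := PosNum (y0 n).
  apply: (@beurling_matrix_non_quasianalytic R r'.+1 {posnum R} M (fun n => M (y n))
    (fun n => wm_norm0 wM (y n)) (fun n => weight_matrix_ge1 wM (y n))).
  + exact: wm_pos.
  (* The maximum ensures both [N <= n] and [1 / n.+1 <= x]. *)
  + move=> x N; pose n := maxn N (Num.truncn (x%:num^-1)).
    exists n; first exact: leq_maxl.
    apply: wm_mono => //; rewrite -num_le /=.
    rewrite invf_ple ?posrE//.
    apply: le_trans (ltW (truncnS_gt _)) _; rewrite ler_nat ltnS; exact: leq_maxr.
  + move=> n; apply: roumieu_slope_summable; first exact: wm_norm0.
    exact: ultra_class_roumieu (H _).
Qed.
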